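(* For every $0<\varepsilon\le 1$ there is an online algorithm for the fractional allocation problem on a weighted star with the following guarantee. For every instance with cost vectors $h^1,h^2,\dots$, starting configuration $x^0$ and quota pattern $\kappa=(\kappa(1),\kappa(2),\dots)$, $$\mathrm{Hit}_{\mathrm{ALG}}\le(1+\varepsilon)\big(\mathrm{OPT}+w_{\max}\,g(\kappa)\big)+C,\qquad \mathrm{Mov}_{\mathrm{ALG}}\le O(\log(k/\varepsilon))\cdot\big(\mathrm{OPT}+w_{\max}\,g(\kappa)\big),$$ where $C$ is a quantity depending only on the starting and final configurations of the online algorithm, with $C=0$ if these two configurations coincide.
   Context: Weighted star: locations $1,\dots,d$, location $i$ at distance $w_i>0$ from the center; $w_{\max}=\max_i w_i$. At each time $t$ a quota $\kappa(t)\le k$ (a nonnegative integer) is given and a cost vector $h^t=(h^t(0),\dots,h^t(k))$ with $h^t(0)\ge h^t(1)\ge\dots\ge h^t(k)\ge 0$ arrives at a location $i_t$ ($h^t(j)$ is the cost of serving the request with exactly $j$ servers at $i_t$). A fractional state is $x^t=(x^t_{i,j})_{i\in[d],\,0\le j\le k}$ with $x^t_{i,j}\ge0$, $\sum_j x^t_{i,j}=1$ for each $i$, and $\sum_i\sum_j j\,x^t_{i,j}\le\kappa(t)$. An online algorithm chooses $x^t$ after seeing $\kappa(t),h^t,i_t$ (and the past). Hit cost at time $t$: $\sum_j h^t(j)x^t_{i_t,j}$; movement cost at time $t$: $\sum_i w_i\sum_{j=1}^k\big|\sum_{j'<j}x^t_{i,j'}-\sum_{j'<j}x^{t-1}_{i,j'}\big|$.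 $\mathrm{Hit}_{\mathrm{ALG}}$ and $\mathrm{Mov}_{\mathrm{ALG}}$ are the total hit and movement costs of the online algorithm. $\mathrm{OPT}$ is the total hit plus movement cost of an optimal integral solution (all $x^t_{i,j}\in\{0,1\}$) starting from the same initial configuration $x^0$, assumed integral. $g(\kappa)=\sum_t|\kappa(t)-\kappa(t-1)|$, with $\kappa(0)$ the initial quota. *)

(* Defs.v *)
From HB Require Import structures.
From mathcomp Require Import all_boot all_order all_algebra.
From mathcomp Require Import all_classical all_reals all_analysis.

Set Implicit Arguments.
Unset Strict Implicit.
Unset Printing Implicit Defensive.

Import Order.TTheory GRing.Theory Num.Theory.
Local Open Scope classical_set_scope.
Local Open Scope ring_scope.

Record star (R : realType) := Star {
  nloc : nat;
  weight : 'I_nloc -> R;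
  weight_gt0 : forall i, 0 < weight i
}.

Definition wmax (R : realType) (S : star R) : R :=
  \big[Num.max/0]_(i < nloc S) weight i.

(* [x i j] is the fraction of "exactly j servers at location i". *)
Definition state (R : realType) (S : star R) (k : nat) : Type :=
  'M[R]_(nloc S, k.+1).

Definition is_state (R : realType) (S : star R) (k : nat) (q : nat)
    (x : state S k) : Prop :=
  [/\ forall i j, 0 <= x i j,
      forall i, \sum_(j < k.+1) x i j = 1 &
      \sum_i \sum_(j < k.+1) (j : nat)%:R * x i j <= q%:R].

Definition integral_state (R : realType) (S : star R) (k : nat)
    (x : state S k) : Prop :=
  forall i j, x i j = 0 \/ x i j = 1.

Record request (R : realType) (S : star R) (k : nat) := Request {
  req_quota : nat;
  req_loc : 'I_(nloc S);
  req_cost : 'I_k.+1 -> R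
}.

(* Requests arrive at times t >= 1: [loc _ 0] and [hcost _ 0] are never used,
   whereas [kappa _ 0] is the initial quota. *)
Record instance (R : realType) (S : star R) (k : nat) := Instance {
  start : state S k;
  kappa : nat -> nat;
  loc : nat -> 'I_(nloc S);
  hcost : nat -> 'I_k.+1 -> R
}.

Definition valid_instance (R : realType) (S : star R) (k : nat)
    (I : instance S k) : Prop :=
  [/\ forall t, (kappa I t <= k)%N,
      forall t, (0 < t)%N ->
        (forall j, 0 <= hcost I t j) /\
        (forall j j' : 'I_k.+1, (j <= j')%N -> hcost I t j' <= hcost I t j),
      is_state (kappa I 0) (start I) &
      integral_state (start I)].

Definition history (R : realType) (S : star R) (k : nat) (I : instance S k)
    (t : nat) : seq (request S k) :=
  [seq Request (kappa I s) (loc I s) (hcost I s) | s <- iota 1 t].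

(* An algorithm is given the star, k, the starting configuration and the
   initial quota; at each time t >= 1 it picks its new state from the requests
   seen so far, the current one included. *)
Definition online_algorithm (R : realType) : Type :=
  forall (S : star R) (k : nat),
    state S k -> nat -> seq (request S k) -> state S k.

Definition run (R : realType) (A : online_algorithm R) (S : star R) (k : nat)
    (I : instance S k) (t : nat) : state S k :=
  if t is 0 then start I else A S k (start I) (kappa I 0) (history I t).

Definition solution (R : realType) (S : star R) (k : nat) (I : instance S k)
    (T : nat) (x : nat -> state S k) : Prop :=
  x 0%N = start I /\
  forall t, (0 < t <= T)%N -> is_state (kappa I t) (x t).

Definition hit (R : realType) (S : star R) (k : nat) (I : instance S k)
    (T : nat) (x : nat -> state S k) : R :=
  \sum_(1 <= t < T.+1) \sum_(j < k.+1) hcost I t j * x t (loc I t) j.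

Definition cumul (R : realType) (S : star R) (k : nat) (x : state S k)
    (i : 'I_(nloc S)) (j : nat) : R :=
  \sum_(j' < k.+1 | (j' < j)%N) x i j'.

Definition move (R : realType) (S : star R) (k : nat) (x y : state S k) : R :=
  \sum_i weight i * \sum_(1 <= j < k.+1) `|cumul y i j - cumul x i j|.

Definition mov (R : realType) (S : star R) (k : nat) (T : nat)
    (x : nat -> state S k) : R :=
  \sum_(1 <= t < T.+1) move (x t.-1) (x t).

(* The infimum is over the nonempty set of costs of the feasible integral
   solutions up to time T; there are finitely many such costs, so it is the
   cost of an optimal integral solution. *)
Definition opt (R : realType) (S : star R) (k : nat) (I : instance S k)
    (T : nat) : R :=
  inf [set c : R | exists y : nat -> state S k,
    [/\ solution I T y,
        forall t, (t <= T)%N -> integral_state (y t) &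
        c = hit I T y + mov T y]].

Definition quota_var (R : realType) (S : star R) (k : nat) (I : instance S k)
    (T : nat) : R :=
  \sum_(1 <= t < T.+1) `|(kappa I t)%:R - (kappa I t.-1)%:R|.

(* Main.v *)
Require Import Defs.
From HB Require Import structures.
From mathcomp Require Import all_boot all_order all_algebra.
From mathcomp Require Import all_classical all_reals all_analysis.
From mathcomp Require Import ring lra zify.

(* In the cumulative variables z_(i,j) = P(fewer than j servers at i), 1 <= j <= k,
   the allocation problem is fractional weighted paging with the extra constraint
   that z_(i,j) is monotone in j: the quota reads sum z >= d k - kappa, the hit
   cost is h(k) + sum_j (h(j-1) - h(j)) z_(i,j), and the movement is a weighted
   l1 distance.  The algorithm is an entropic proximal step with shift
   delta = 1/k and rate eta = ln(1 + k) = ln((1 + delta)/delta): the log-levels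
   ln(z + delta) of the requested location are lowered by eta/w times the cost
   increments and made monotone by isotonic regression, then all log-levels are
   raised by A/w and clipped to [0,1], where A >= 0 and A = 0 unless the quota
   is met with equality.
   The potential sum w ((c y + delta) ln((y + delta)/(z + delta)) - y + z) against
   an integral solution y, with c = 1, gives Hit <= OPT.  With c = 2 the multiplier
   A contributes an extra negative term, proportional to the number of
   unsaturated pages that y leaves out, which pays for all upward movement; here
   the integrality of y is used.  The same potential dominates the weighted
   excess of y over z, so that downward movement is bounded by upward movement
   with no additive constant. *)

Set Implicit Arguments.
Unset Strict Implicit.
Unset Printing Implicit Defensive.

Import Order.TTheory GRing.Theory Num.Theory.
Import numFieldNormedType.Exports.
Local Open Scope ring_scope.

(** * Isotonic regression *)

(** Summation by parts: the right side minus the left side is a sum of increments of [y] times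
    partial sums of [g]. *)
Lemma sum_nondecreasing_prefix (R : realDomainType) (n : nat) (y g : nat -> R) :
  (forall i j, (i <= j <= n)%N -> y i <= y j) ->
  (forall j, (j <= n)%N -> 0 <= \sum_(l < j) g l) ->
  \sum_(l < n.+1) y l * g l <= y n * \sum_(l < n.+1) g l.
Proof.
elim: n => [|n IHn] hy hg; first by rewrite !big_ord_recr !big_ord0 /= !add0r.
rewrite big_ord_recr [in leRHS]big_ord_recr /= mulrDr lerD2r.
apply: le_trans (IHn _ _) _ => [i j ij|j jn|]; [apply: hy; lia|apply: hg; lia|].
by apply: ler_wpM2r; [exact: hg|apply: hy; lia].
Qed.

(* [m] is the sequence of slopes of the greatest convex minorant of the partial
   sums of [v]; the third clause bundles monotonicity and complementary slackness
   of the multipliers [\sum_(l < j) (v l - m l)]. *)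
Lemma isotonic_regression (R : realFieldType) (n : nat) (v : nat -> R) :
  exists m : nat -> R,
  [/\ forall i j, (i <= j < n)%N -> m i <= m j,
      forall L : nat -> R, (forall i j, (i <= j < n)%N -> L i <= L j) ->
        (forall j, (j < n)%N -> v j <= L j) ->
        forall j, (j < n)%N -> m j <= L j,
      forall (f : R -> R) (y : nat -> R),
        (forall i j, (i <= j < n)%N -> y i <= y j) ->
        \sum_(l < n) (f (m l) - y l) * (m l - v l) <= 0 &
      forall c, (forall j, (j <= n)%N -> c * j%:R <= \sum_(l < j) v l) ->
        forall j, (j < n)%N -> c <= m j].
Proof.
(* The first block of [m] is a prefix of [v] of least average. *)
have [N] := ubnP n; elim: N => // N IHN in n v *.
case: n => [|n] nN.
  by exists v; split => // [i j|f y _]; [lia|rewrite big_ord0].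
pose avg (i : 'I_n.+1) : R := (\sum_(l < i.+1) v l) / i.+1%:R.
pose p := [arg min_(i < ord0) avg i]%O.
have avgp i : avg p <= avg i by rewrite /p; case: arg_minP => // i0 _; apply.
have pn : (p.+1 <= n.+1)%N by exact: ltn_ord.
set c := avg p in avgp.
have sumc : \sum_(l < p.+1) v l = c * p.+1%:R by rewrite /c /avg divfK.
have prec j : (j <= n.+1)%N -> c * j%:R <= \sum_(l < j) v l.
  case: j => [|j] jn; first by rewrite mulr0 big_ord0.
  by have := avgp (Ordinal jn); rewrite /avg/= ler_pdivlMr ?ltr0n.
have [m' [m'mono m'L m'f m'c]] := IHN (n - p)%N (fun l => v (p.+1 + l)%N) ltac:(lia).
(* Since [c] is a least prefix average, every prefix of the tail averages at least [c]. The last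
   clause of the induction hypothesis carries this over to the slopes of the tail, so the two pieces
   glue monotonically. *)
have cm' j : (j < n - p)%N -> c <= m' j.
  apply: m'c => i ip; have := prec (p.+1 + i)%N ltac:(lia).
  by rewrite big_split_ord/= sumc natrD mulrDr lerD2l.
pose m l := if (l < p.+1)%N then c else m' (l - p.+1)%N.
have mono i j : (i <= j < n.+1)%N -> m i <= m j.
  rewrite /m => ij; case: ltnP => ip; case: ltnP => jp //; [apply: cm'; lia| lia|].
  apply: m'mono; lia.
exists m; split => //.
- move=> L Lmono vL j jn; rewrite /m; case: ltnP => jp; last first.
    have := m'L (fun l => L (p.+1 + l)%N) _ _ (j - p.+1)%N.
    rewrite subnKC //; apply; last by lia.
      by move=> a b ab; apply: Lmono; lia.
    by move=> a b; apply: vL; lia.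
  rewrite -(ler_pM2r (ltr0Sn R j)); apply: (le_trans (prec j.+1 jn)).
  rewrite mulr_natr -[X in _ *+ X]card_ord -sumr_const; apply: ler_sum => i _.
  by apply: le_trans (vL _ _) (Lmono _ _ _); have := ltn_ord i; lia.
- move=> f y ymono; have -> : n.+1 = (p.+1 + (n - p))%N by lia.
  rewrite big_split_ord/=.
  rewrite -[leRHS]addr0; apply: lerD; last first.
    under eq_bigr => i _.
      rewrite /m ifF ?addKn; last by lia.
      over.
    apply: (m'f f (fun l => y (p.+1 + l)%N)) => a b ab; apply: ymono; lia.
  (* On the first block [f (m l)] is constant and [m - v] sums to zero, so [f] drops out; the prefix
     sums of [v - c] are nonnegative. *)
  under eq_bigr => i _.
    rewrite /m ltn_ord mulrBl -[y i * _]opprK -mulrN opprB opprK.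
    over.
  rewrite big_split/= -mulr_sumr sumrB sumr_const card_ord sumc mulr_natr subrr.
  rewrite mulr0 add0r.
  apply: le_trans (sum_nondecreasing_prefix (y := y) (g := fun l => v l - c) _ _) _.
  + by move=> a b ab; apply: ymono; lia.
  + move=> j jp; rewrite sumrB sumr_const card_ord subr_ge0 -mulr_natr.
    apply: prec; lia.
  + by rewrite sumrB sumr_const card_ord sumc mulr_natr subrr mulr0.
- move=> c0 hc0 j jn; have c0c : c0 <= c.
    by have := hc0 p.+1 pn; rewrite sumc ler_pM2r ?ltr0n.
  by apply: (le_trans c0c); have := mono 0%N j ltac:(lia); rewrite {1}/m.
Qed.

(** * Entropic step on weighted pages *)

(** This is [ln t <= t - 1] at [t = p / q]; the entropy estimates below rest on it. *)
Lemma sub_le_mul_lnB (R : realType) (p q : R) :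
  0 < p -> 0 < q -> q - p <= q * (ln q - ln p).
Proof.
move=> p0 q0; rewrite -lerN2 opprB -mulrN opprB -ln_div //.
have := @le_ln1Dx R (p / q - 1).
rewrite [1 + _]addrC subrK ltrBrDr addNr divr_gt0// => /(_ isT) h.
by move: h; rewrite -(ler_pM2l q0 (ln _)) mulrBr [q * (p / q)]mulrC divfK ?gt_eqF// mulr1.
Qed.

Definition clip01 (R : realType) (x : R) : R := Num.min 1 (Num.max 0 x).

Lemma continuous_clip01 (R : realType) : continuous (@clip01 R).
Proof.
move=> x; apply: (@continuous_min _ _ (fun=> 1) (fun x : R => Num.max 0 x)).
  exact: cst_continuous.
apply: (@continuous_max _ _ (fun=> 0) id); last exact: cvg_id.
exact: cst_continuous.
Qed.

Lemma clip01_ge0 (R : realType) (x : R) : 0 <= clip01 x.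
Proof. by rewrite le_min ler01 le_max lexx. Qed.

Lemma clip01_le1 (R : realType) (x : R) : clip01 x <= 1.
Proof. by rewrite ge_min lexx. Qed.

Lemma le_clip01 (R : realType) : {homo @clip01 R : x y / x <= y}.
Proof. by move=> x y xy; apply: le_min2 => //; apply: le_max2. Qed.

Lemma clip01_le (R : realType) (x : R) : 0 < clip01 x -> clip01 x <= x.
Proof.
by rewrite lt_min ltr01 lt_max ltxx/= ge_min ge_max lexx => /ltW ->; rewrite orbT.
Qed.

Lemma le_clip01_id (R : realType) (x : R) : clip01 x < 1 -> x <= clip01 x.
Proof. by rewrite gt_min ltxx/= gt_max => /andP[_ /ltW x1]; rewrite le_min x1 le_max lexx orbT. Qed.

Lemma ln_clip01_le (R : realType) (u d : R) : 0 < d ->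
  0 < clip01 (expR u - d) -> ln (clip01 (expR u - d) + d) <= u.
Proof.
move=> d0 c0; rewrite -[leRHS]expRK ler_ln ?posrE ?expR_gt0 ?addr_gt0//.
by rewrite -lerBrDr clip01_le.
Qed.

Lemma le_ln_clip01 (R : realType) (u d : R) : 0 < d ->
  clip01 (expR u - d) < 1 -> u <= ln (clip01 (expR u - d) + d).
Proof.
move=> d0 c1; rewrite -[leLHS]expRK ler_ln ?posrE ?expR_gt0//; last first.
  by rewrite ltr_wpDl// clip01_ge0.
by rewrite -lerBlDr le_clip01_id.
Qed.

(** Intermediate value theorem in [A]. The alternative in the last clause is complementary slackness
    for the quota. *)
Lemma exists_multiplier (R : realType) (F : finType) (w m : F -> R) (d N : R) :
  (forall f, 0 < w f) -> N <= #|F|%:R ->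
  exists A : R, let z f := clip01 (expR (m f + A / w f) - d) in
    [/\ 0 <= A, N <= \sum_f z f & A = 0 \/ \sum_f z f = N].
Proof.
move=> w0 NF; pose h (A : R) : R := \sum_f clip01 (expR (m f + A / w f) - d).
have [h0|h0] := leP N (h 0); first by exists 0; split; rewrite ?h0//; left.
pose Bf f : R := `|ln (1 + `|d|) - m f|.
(* So large that [A1 / w f >= Bf f] for every [f], which lifts every page to the cap 1. *)
pose A1 := (\sum_f w f) * \sum_f Bf f.
have w0' f : 0 <= w f by exact: ltW.
have A10 : 0 <= A1 by rewrite mulr_ge0// sumr_ge0// => f _; rewrite /Bf.
have hA1 : h A1 = #|F|%:R.
  rewrite -sum1_card natr_sum; apply: eq_bigr => f _.
  apply/le_anti; rewrite clip01_le1/=; apply: le_trans (le_clip01 (x := 1) _).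
    by rewrite /clip01 max_r// minxx.
  rewrite lerBrDr; apply: (@le_trans _ _ (1 + `|d|)); first by rewrite lerD2l ler_norm.
  have d1 : 0 < 1 + `|d| by rewrite ltr_pwDl.
  rewrite -[leLHS]lnK ?posrE// ler_expR -lerBlDl ler_pdivlMr//.
  apply: le_trans (ler_norm _) _; rewrite normrM (ger0_norm (w0' f)) mulrC.
  apply: ler_pM => //.
    by rewrite (bigD1 f)//= lerDl sumr_ge0.
  by rewrite (bigD1 f)//= lerDl sumr_ge0// => g _; rewrite /Bf.
have hcont : continuous h.
  have fcont f : continuous (fun x : R => clip01 (expR (m f + x / w f) - d)).
    move=> x.
    apply: (@continuous_comp _ _ _ (fun x : R => expR (m f + x / w f) - d)).
      apply: cvgB; last exact: cvg_cst.
      apply: (@continuous_comp _ _ _ (fun x : R => m f + x / w f) expR); last exact: continuous_expR.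
      apply: cvgD; first exact: cvg_cst.
      apply: cvgMr_tmp; exact: cvg_id.
    exact: continuous_clip01.
  apply: (@continuous_big R F +%R 0 predT) => [|f _]; first exact: add_continuous.
  exact: fcont.
have [//||A /andP[/= A0 _] hA] := @IVT R h 0 A1 N A10.
- exact: continuous_subspaceT.
- by rewrite hA1 ge_min (ltW h0)/= le_max NF orbT.
- by exists A; split; [exact: A0|rewrite -hA|right].
Qed.

(** For [c = 1] this is the Bregman divergence of the entropy between [y + d] and [z + d]. Its
    derivative in [z] is [(z - c * y) / (z + d)], which is why log-level increments are multiplied
    by [z - c * y] below. *)
Definition pot_term (R : realType) (d c y z : R) : R :=
  (c * y + d) * (ln (y + d) - ln (z + d)) - y + z.

(* A page is a pair (location, level) with level [old] before the step, log-level
   [m] after lowering, and new level [z]; [u = m + A / w] and [ln (z + d)] is [u]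
   clipped to [[ln d, ln (1 + d)]]. *)
Section PageStep.
Variables (R : realType) (d w A old z u m y : R).
Hypotheses (d0 : 0 < d) (w0 : 0 < w) (A0 : 0 <= A).
Hypotheses (old01 : 0 <= old <= 1) (z01 : 0 <= z <= 1) (y01 : y = 0 \/ y = 1).
Local Notation L := (ln (old + d)).
Local Notation r := (ln (z + d)).
Hypotheses (m_le : m <= L) (wu : w * u = w * m + A).
Hypotheses (ru : 0 < z -> r <= u) (ur : z < 1 -> u <= r).

Let z0 : 0 <= z. Proof. by case/andP: z01. Qed.
Let z1 : z <= 1. Proof. by case/andP: z01. Qed.
Let zd : 0 < z + d. Proof. by rewrite ltr_wpDl. Qed.
Let od : 0 < old + d. Proof. by case/andP: old01 => o0 _; rewrite ltr_wpDl. Qed.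
Let zo : z - old <= (z + d) * (r - L).
Proof. by have := sub_le_mul_lnB od zd; rewrite opprD addrACA subrr addr0. Qed.

Lemma pot_term_step (c : R) :
  w * (pot_term d c y z - pot_term d c y old) <= (z - c * y) * (w * (r - L)).
Proof. rewrite mulrCA ler_pM2l// /pot_term; move: zo; lra. Qed.

(** Clipping only helps: [r - u] is nonpositive at [z = 1], where [z - y >= 0], nonnegative at
    [z = 0], where [z - y <= 0], and zero in between. *)
Lemma pot_term1_step :
  w * (pot_term d 1 y z - pot_term d 1 y old) <= (z - y) * (A - w * (L - m)).
Proof.
apply: le_trans (pot_term_step 1) _; rewrite mul1r.
have -> : w * (r - L) = A - w * (L - m) + w * (r - u) by move: wu; lra.
rewrite mulrDr gerDl mulrCA pmulr_rle0//.
have [zp|zn] := ltP 0 z; have [zl|zl] := ltP z 1.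
- rewrite (_ : r - u = 0) ?mulr0//; apply/le_anti; by rewrite subr_le0 subr_ge0 ru// ur.
- have := ru zp; have -> : z = 1 by apply/le_anti; rewrite z1.
  by case: y01 => -> ?; rewrite ?subrr ?mul0r// subr0 mul1r subr_le0.
- have := ur zl; have -> : z = 0 by apply/le_anti; rewrite z0 zn.
  by case: y01 => -> ?; rewrite ?subrr ?mul0r// sub0r mulN1r opprB subr_le0.
- by move: (lt_le_trans (@ltr01 R) zl); rewrite ltNge zn.
Qed.

(** The sign argument for clipping now fails only at [y = z = 1], where [z - 2 * y = -1]; the last
    term is the correction for these saturated pages. *)
Lemma pot_term2_step :
  w * (pot_term d 2 y z - pot_term d 2 y old) <=
    (z - 2 * y) * (A - w * (L - m))
    + ((y == 1) && (z == 1))%:R * (A - w * (r - L)).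
Proof.
apply: le_trans (pot_term_step 2) _.
have e : w * (r - L) = A - w * (L - m) + w * (r - u) by move: wu; lra.
rewrite {1}e mulrDr lerD2l mulrCA.
have wLm : 0 <= w * (L - m) by rewrite pmulr_rge0// subr_ge0.
have [zl|zl] := ltP z 1.
  rewrite [z == 1]lt_eqF// andbF mul0r pmulr_rle0//.
  have [zp|zn] := ltP 0 z.
    rewrite (_ : r - u = 0) ?mulr0//; apply/le_anti; by rewrite subr_le0 subr_ge0 ru// ur.
  have := ur zl; have -> : z = 0 by apply/le_anti; rewrite z0 zn.
  by case: y01 => -> ?; lra.
have ze : z = 1 by apply/le_anti; rewrite z1.
have := ru (lt_le_trans (@ltr01 R) zl) => ru1.
rewrite ze in ru1 e *; rewrite eqxx andbT.
case: y01 => ->; rewrite ?eqxx ?[0 == 1]eq_sym ?oner_eq0 /=.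
  by rewrite mul0r mulr0 subr0 mul1r pmulr_rle0//; lra.
by rewrite mul1r; lra.
Qed.

(** On a saturated page [z + d <= 2]. On the others [r <= u] and [m <= L] give
    [w * (r - L) <= A]. *)
Lemma up_step : d <= 1 ->
  w * Num.max 0 (z - old) <=
    2 * (((y == 1) && (z == 1))%:R * (w * (r - L)))
    + A * ((~~ ((y == 1) && (z == 1)))%:R * ((0 < z)%R%:R * (z + d))).
Proof.
move=> d1; case/andP: (old01) => o0 o1.
have wd : 0 <= w by exact: ltW.
case: (boolP (_ && _)) => [/andP[_ /eqP ze]|_] /=; rewrite ?(mul1r, mul0r, mulr0, addr0, add0r).
  have rL : 0 <= r - L by rewrite subr_ge0 ler_ln ?posrE// lerD2r ze.
  rewrite max_r ?subr_ge0 ?ze// mulrCA ler_pM2l// -ze.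
  by apply: le_trans zo _; apply: ler_wpM2r => //; lra.
have [zo'|oz] := leP z old.
  by rewrite max_l ?subr_le0// mulr0 mulr_ge0// mulr_ge0// ltW.
have zp : 0 < z by exact: le_lt_trans oz.
rewrite max_r ?subr_ge0 ?(ltW oz)// zp mul1r.
apply: (@le_trans _ _ (w * ((z + d) * (r - L)))); first by rewrite ler_pM2l.
rewrite mulrCA [leRHS]mulrC ler_pM2l//.
have := ler_wpM2l wd (ru zp); have := ler_wpM2l wd m_le; rewrite wu; lra.
Qed.
End PageStep.

(** * Summation of the page estimates over all pages *)

Section PagesStep.
Variables (R : realType) (F : finType) (d A N q : R) (w old m y : F -> R).
Hypotheses (d0 : 0 < d) (d1 : d <= 1) (w0 : forall f, 0 < w f) (A0 : 0 <= A).
Hypotheses (old01 : forall f, 0 <= old f <= 1).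
Hypotheses (y01 : forall f, y f = 0 \/ y f = 1).
Hypothesis m_le : forall f, m f <= ln (old f + d).
Let z f := clip01 (expR (m f + A / w f) - d).
Hypotheses (tight : A = 0 \/ \sum_f z f = N) (yN : N <= \sum_f y f).
Hypotheses (FN : #|F|%:R <= N + q) (dq : d * q <= 1).

Let z01 f : 0 <= z f <= 1. Proof. by rewrite clip01_ge0 clip01_le1. Qed.
Let wu f : w f * (m f + A / w f) = w f * m f + A.
Proof. by rewrite mulrDr [w f * (_ / _)]mulrC divfK ?gt_eqF. Qed.
Let ru f : 0 < z f -> ln (z f + d) <= m f + A / w f.
Proof. exact: ln_clip01_le. Qed.
Let ur f : z f < 1 -> m f + A / w f <= ln (z f + d).
Proof. exact: le_ln_clip01. Qed.

(** The multiplier contributes [A] times the sum of [z - y], which is nonpositive: either [A = 0],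
    or the sum of [z] is [N] and that of [y] is at least [N]. *)
Lemma pot1_pages_step :
  \sum_f w f * pot_term d 1 (y f) (z f)
    + \sum_f (z f - y f) * (w f * (ln (old f + d) - m f))
  <= \sum_f w f * pot_term d 1 (y f) (old f).
Proof.
rewrite -lerBrDl -sumrB -subr_ge0 -sumrB.
apply: (@le_trans _ _ (A * \sum_f (y f - z f))).
  rewrite sumrB; case: tight => [->|->]; first by rewrite mul0r.
  by rewrite mulr_ge0// subr_ge0.
rewrite mulr_sumr; apply: ler_sum => f _.
have := pot_term1_step d0 (w0 f) (old01 f) (z01 f) (y01 f) (wu f) (@ru f) (@ur f).
lra.
Qed.

(* [Q] counts the unsaturated pages with [y = 1]: a natural number, so it is
   either 0 or large enough to absorb the shifts [d] of all unsaturated pages. *)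
Let s f := (y f == 1) && (z f == 1).
Let Q := \sum_f (y f - (s f)%:R).
Let W := \sum_f (s f)%:R * (w f * (ln (z f + d) - ln (old f + d))).

Let W0 : 0 <= W.
Proof.
apply: sumr_ge0 => f _; rewrite /s; case: (boolP (_ && _)) => [/andP[_ /eqP ze]|_]; last by rewrite mul0r.
case/andP: (old01 f) => o0 o1.
rewrite mul1r pmulr_rge0// subr_ge0 ler_ln ?posrE ?ze ?lerD2r//; first by rewrite ltr_wpDl.
by rewrite ltr_wpDl.
Qed.

Let Qnat : Q = #|[pred f | (y f == 1) && (z f != 1)]|%:R.
Proof.
rewrite -sum1_card natr_sum big_mkcond/=; apply: eq_bigr => f _.
rewrite inE /s; case: (y01 f) => ->; rewrite ?eqxx ?[0 == 1]eq_sym ?oner_eq0/= ?subrr//.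
by case: eqP => /=; rewrite ?subrr ?subr0.
Qed.

Let mass_unsaturated : 
  A * \sum_f ((~~ s f)%:R * ((0 < z f)%R%:R * (z f + d))) <= 3 * (A * Q).
Proof.
case: tight => [->|zN]; first by rewrite !mul0r mulr0.
rewrite mulrCA ler_wpM2l//.
have sumz : \sum_f (~~ s f)%:R * z f = N - \sum_f (s f)%:R.
  rewrite -zN -sumrB; apply: eq_bigr => f _; rewrite /s.
  case: (boolP (_ && _)) => [/andP[_ /eqP ->]|_] /=; rewrite ?mul0r ?mul1r ?subrr ?subr0//.
have zQ : \sum_f (~~ s f)%:R * z f <= Q by rewrite sumz /Q sumrB lerD2r.
have z0 f : 0 <= z f by case/andP: (z01 f).
case: (posnP #|[pred f | (y f == 1) && (z f != 1)]|) => Q0.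
  (* If [Q = 0], unsaturated pages carry no level, and the indicator of [0 < z] removes their
     shifts. *)
  rewrite Qnat Q0 in zQ *; rewrite mulr0 big1// => f _.
  have /psumr_eq0P : \sum_f (~~ s f)%:R * z f = 0.
    by apply/le_anti; rewrite zQ sumr_ge0// => g _; rewrite mulr_ge0.
  move=> /(_ (fun g _ => mulr_ge0 (ler0n _ _) (z0 g))) /(_ f isT) /eqP.
  rewrite mulf_eq0 => /orP[/eqP->|/eqP->]; first by rewrite mul0r.
  by rewrite ltxx mul0r mulr0.
have Q1 : 1 <= Q by rewrite Qnat ler1n.
apply: (@le_trans _ _ (\sum_f ((~~ s f)%:R * z f + d * (1 - (s f)%:R)))).
  apply: ler_sum => f _; case: (s f); rewrite /= ?mul0r ?mul1r ?subrr ?subr0 ?mulr0 ?addr0//.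
  have [zp|zn] := ltP 0 (z f); rewrite ?mul1r ?mul0r ?mulr1//.
  by rewrite addr_ge0// ltW.
rewrite big_split/= -mulr_sumr sumrB sumr_const.
have h : \sum_f (s f)%:R >= N - Q by rewrite /Q sumrB opprB; move: yN; lra.
(* At most [q + Q] pages are unsaturated, so their shifts total at most [1 + Q <= 2 * Q]; with the
   level mass [Q] this gives the factor 3. *)
have : d * (1 *+ #|F| - \sum_f (s f)%:R) <= d * (q + Q).
  by rewrite ler_pM2l//; move: FN h; rewrite -[1 *+ _]/(_%:R); lra.
have : d * Q <= Q by rewrite ler_piMl//; move: Q1; lra.
move: zQ Q1 dq; lra.
Qed.

(** Upward movement is at most [2 * W + 3 * (A * Q)], while the potential releases [W + A * Q]:
    hence the division by 3. *)
Lemma pot2_pages_step :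
  \sum_f w f * pot_term d 2 (y f) (z f)
    + (\sum_f w f * Num.max 0 (z f - old f)) / 3
    + \sum_f (z f - 2 * y f) * (w f * (ln (old f + d) - m f))
  <= \sum_f w f * pot_term d 2 (y f) (old f).
Proof.
have up : \sum_f w f * Num.max 0 (z f - old f) <= 2 * W + 3 * (A * Q).
  apply: le_trans (lerD (lexx _) mass_unsaturated).
  rewrite !mulr_sumr -big_split/=; apply: ler_sum => f _.
  exact: up_step (m_le f) (wu f) (@ru f) d1.
have pot : \sum_f w f * (pot_term d 2 (y f) (z f) - pot_term d 2 (y f) (old f))
    <= - \sum_f (z f - 2 * y f) * (w f * (ln (old f + d) - m f)) - A * Q - W.
  apply: (@le_trans _ _ (\sum_f ((z f - 2 * y f) * (A - w f * (ln (old f + d) - m f))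
    + (s f)%:R * (A - w f * (ln (z f + d) - ln (old f + d)))))).
    by apply: ler_sum => f _; exact: pot_term2_step (m_le f) (wu f) (@ru f) (@ur f).
  (* Here [z - 2 * y + s] is split as [(z - y) - (y - s)], and the second part sums to [Q]. *)
  apply: (@le_trans _ _ (A * (\sum_f (z f - y f)) - A * Q - W
      - \sum_f (z f - 2 * y f) * (w f * (ln (old f + d) - m f)))).
    rewrite /Q /W !mulr_sumr -!sumrB; apply: ler_sum => f _; lra.
  suff : A * \sum_f (z f - y f) <= 0 by lra.
  rewrite sumrB; case: tight => [->|->]; first by rewrite mul0r.
  by rewrite mulr_ge0_le0// subr_le0.
move: pot; under eq_bigr do rewrite mulrBr.
rewrite sumrB; move: up W0; lra.
Qed.
End PagesStep.

(** * Bounds on a single potential term *)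

Section PotTerm.
Variables (R : realType) (d : R).
Hypotheses (d0 : 0 < d) (d1 : d <= 1).

Lemma pot_term_id (c y : R) : pot_term d c y y = 0.
Proof. by rewrite /pot_term subrr mulr0 sub0r addNr. Qed.

(** At [y = 1] the entropy inequality uses up [1 + d] of the coefficient [c + d]; the surplus
    [c - 1], times a log gap of at least [(1 - z) / 2], pays for [b]. Taking [b = 0] gives
    nonnegativity. *)
Lemma pot_term_ge (b c y z : R) : 0 <= b -> 1 + 2 * b <= c ->
  y = 0 \/ y = 1 -> 0 <= z <= 1 -> b * (y - z) <= pot_term d c y z.
Proof.
move=> b0 bc y01 /andP[z0 z1]; rewrite /pot_term.
have zd : 0 < z + d by rewrite ltr_wpDl.
case: y01 => ->.
  have := sub_le_mul_lnB zd d0; rewrite mulr0 !add0r.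
  have : 0 <= b * z by rewrite mulr_ge0.
  lra.
have d1' : 0 < 1 + d by rewrite ltr_wpDl.
have h := sub_le_mul_lnB zd d1'.
set l := ln (1 + d) - ln (z + d) in h *.
have hl : (1 - z) / 2 <= l.
  rewrite ler_pdivrMr//; have l0 : 0 <= l by rewrite -(pmulr_rge0 _ d1'); lra.
  have : 0 <= (1 - d) * l by apply: mulr_ge0 => //; rewrite subr_ge0.
  lra.
have : 0 <= (c - 1) * (l - (1 - z) / 2) by apply: mulr_ge0; lra.
have : 0 <= (c - 1 - 2 * b) * (1 - z) by apply: mulr_ge0; lra.
lra.
Qed.

Lemma pot_term_lipschitz (c y y' z : R) : 1 <= c ->
  y = 0 \/ y = 1 -> y' = 0 \/ y' = 1 -> 0 <= z <= 1 ->
  pot_term d c y' z <= pot_term d c y z + c * (ln (1 + d) - ln d) * `|y' - y|.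
Proof.
move=> c1 y01 y01' /andP[z0 z1].
have zd : 0 < z + d by rewrite ltr_wpDl.
have d1' : 0 < 1 + d by rewrite ltr_wpDl.
(* With [g = ln (1 + d) - ln d] these say [d * g <= 1 <= (1 + d) * g], one bound for each direction
   in which [y] may flip. *)
have e1 := sub_le_mul_lnB d1' d0; have e2 := sub_le_mul_lnB d0 d1'.
have l1 : ln d <= ln (z + d) by rewrite ler_ln ?posrE// lerDr.
have l2 : ln (z + d) <= ln (1 + d) by rewrite ler_ln ?posrE// lerD2r.
move: e1 e2 l1 l2; rewrite /pot_term.
set a := ln (1 + d); set b := ln d; set x := ln (z + d) => e1 e2 l1 l2.
have h1 : 0 <= (c - 1) * (a - b) by rewrite mulr_ge0// subr_ge0//; lra.
have h2 : 0 <= c * (x - b) by rewrite mulr_ge0//; lra.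
have h3 : 0 <= c * (a - x) by rewrite mulr_ge0//; lra.
have n10 : `|1 - 0| = 1 :> R by rewrite subr0 normr1.
have n01 : `|0 - 1| = 1 :> R by rewrite sub0r normrN1.
have d0E : ln (0 + d) = b by rewrite add0r.
case: y01 => ->; case: y01' => ->; rewrite ?d0E -/a ?n10 ?n01 ?(subrr, normr0); lra.
Qed.

Lemma ln_gap_ge_half : 1 / 2 <= ln (1 + d) - ln d.
Proof.
have d1' : 0 < 1 + d by rewrite ltr_wpDl.
have := sub_le_mul_lnB d0 d1'.
have e0 : 0 <= ln (1 + d) - ln d by rewrite subr_ge0 ler_ln ?posrE// lerDr.
have := ler_wpM2r e0 d1; lra.
Qed.
End PotTerm.

(** * Levels of a state of the star *)

Definition stochastic (R : realType) (S : star R) (k : nat) (x : state S k) :=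
  (forall i j, 0 <= x i j) /\ (forall i, \sum_(j < k.+1) x i j = 1).

Lemma is_state_stochastic (R : realType) (S : star R) (k q : nat)
    (x : state S k) : is_state q x -> stochastic x.
Proof. by case. Qed.

Lemma abel_sum (R : comPzRingType) (n : nat) (h F : nat -> R) :
  \sum_(j < n.+1) h j * F j =
  h n * \sum_(l < n.+1) F l + \sum_(j < n) (h j - h j.+1) * \sum_(l < j.+1) F l.
Proof.
elim: n => [|n IHn]; first by rewrite !big_ord_recr !big_ord0 /= !add0r addr0.
rewrite big_ord_recr/= IHn [in RHS]big_ord_recr [\sum_(i < n.+1) (_ - _) * _]big_ord_recr/=.
by ring.
Qed.

Section Cumul.
Variables (R : realType) (S : star R) (k : nat).
Implicit Types (x y : state S k) (i : 'I_(nloc S)).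

Lemma cumulE x i j : (j <= k.+1)%N ->
  cumul x i j = \sum_(l < j) x i (inord l).
Proof.
move=> jk; rewrite (big_ord_widen _ (fun l => x i (inord l)) jk) /cumul.
by apply: eq_bigr => l _; rewrite inord_val.
Qed.

Lemma sum_cumul x i (h : nat -> R) : stochastic x ->
  \sum_(j < k.+1) h j * x i j =
  h k + \sum_(j < k) (h j - h j.+1) * cumul x i j.+1.
Proof.
move=> [_ x1]; have := abel_sum k h (fun l => x i (inord l)).
under eq_bigr do rewrite inord_val; move=> ->; congr (_ + _).
  by under eq_bigr do rewrite inord_val; rewrite x1 mulr1.
by apply: eq_bigr => j _; rewrite cumulE// ltnS ltnW.
Qed.

Lemma cumul_mono x i j j' : stochastic x -> (j <= j' <= k.+1)%N ->
  cumul x i j <= cumul x i j'.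
Proof.
move=> [x0 _] /andP[jj' jk]; rewrite /cumul big_mkcond [leRHS]big_mkcond/=.
apply: ler_sum => l _; case: ltnP => lj; first by rewrite (leq_trans lj).
by case: ifP.
Qed.

Lemma cumul01 x i j : stochastic x -> (j <= k.+1)%N -> 0 <= cumul x i j <= 1.
Proof.
move=> sx jk; apply/andP; split; first by apply: sumr_ge0 => l _; case: sx.
have [_ /(_ i) <-] := sx; apply: (@le_trans _ _ (cumul x i k.+1)).
  by apply: cumul_mono; rewrite ?jk/=.
by rewrite /cumul big_mkcond/=; apply: ler_sum => l _; rewrite ltn_ord.
Qed.

Lemma cumul_integral x i j : stochastic x -> integral_state x ->
  (j <= k.+1)%N -> cumul x i j = 0 \/ cumul x i j = 1.
Proof.
move=> sx ix jk; have /natrP[n cn] : cumul x i j \is a Num.nat.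
  by apply: rpred_sum => l _; case: (ix i l) => ->; rewrite ?rpred0 ?rpred1.
have := cumul01 i sx jk; rewrite cn lern1.
by case: n {cn} => [|[|n]]//; rewrite ?andbF//; [left|right].
Qed.

(** By parts, the expected number of servers at a location is [k] minus the sum of its levels, so
    the packing constraint becomes a covering one. *)
Lemma is_stateP (q : nat) x : stochastic x ->
  is_state q x <->
  (nloc S * k)%:R - q%:R <= \sum_(p : 'I_(nloc S) * 'I_k) cumul x p.1 p.2.+1.
Proof.
move=> sx; have -> : \sum_(p : 'I_(nloc S) * 'I_k) cumul x p.1 p.2.+1 =
    (nloc S * k)%:R - \sum_i \sum_(j < k.+1) (j : nat)%:R * x i j.
  under [in RHS]eq_bigr do rewrite (@sum_cumul _ _ (fun j => j%:R))//.
  rewrite big_split/= sumr_const card_ord natrM [_ * k%:R]mulr_natl opprD addNKr.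
  rewrite -sumrN -(pair_bigA _ (fun i j => cumul x i (j : 'I_k).+1))/=.
  apply: eq_bigr => i _; rewrite -sumrN; apply: eq_bigr => j _.
  by rewrite -natr1; ring.
rewrite lerD2l lerN2; split => [[] //|h]; by case: sx.
Qed.

(* [Z i j] prescribes [cumul i j.+1], for j < k. *)
Definition of_levels (Z : 'I_(nloc S) -> nat -> R) : state S k :=
  let E i j := if j is j'.+1 then if (j' < k)%N then Z i j' else 1 else 0 in
  \matrix_(i, j) (E i j.+1 - E i j).

Lemma cumul_of_levels (Z : 'I_(nloc S) -> nat -> R) i (j : nat) :
  (j <= k)%N -> cumul (of_levels Z) i j.+1 = if (j < k)%N then Z i j else 1.
Proof.
move=> jk; rewrite cumulE ?ltnS//.
elim: j jk => [|j IHj] jk; rewrite big_ord_recr/=.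
  by rewrite big_ord0 mxE inordK//= add0r subr0.
rewrite (IHj (ltnW jk)) /of_levels mxE inordK ?ltnS//= jk; ring.
Qed.

Lemma stochastic_of_levels (Z : 'I_(nloc S) -> nat -> R) :
  (forall i j, 0 <= Z i j <= 1) ->
  (forall i j j', (j <= j' < k)%N -> Z i j <= Z i j') ->
  stochastic (of_levels Z).
Proof.
move=> Z01 Zm; split => [i j|i].
  rewrite mxE subr_ge0; case: j => [[|j] /= jk]; first by case: ifP => // _; case/andP: (Z01 i 0%N).
  rewrite ltnS in jk; rewrite jk; case: ifP => jk'; first by apply: Zm; lia.
  by case/andP: (Z01 i j).
have := @cumul_of_levels Z i k (leqnn _); rewrite ltnn => <-.
by rewrite /cumul [RHS]big_mkcond/=; apply: eq_bigr => l _; rewrite ltn_ord.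
Qed.

End Cumul.

(** * Existence of a good step for one request *)

Section Step.
Variables (R : realType) (S : star R) (k : nat).
Hypothesis k0 : (0 < k)%N.
Implicit Types (x y : state S k).
Local Notation d := (k%:R^-1 : R).
Local Notation eta := (ln (1 + d) - ln d).

Definition potential (c : R) y x : R :=
  \sum_(p : 'I_(nloc S) * 'I_k)
    weight p.1 * pot_term d c (cumul y p.1 p.2.+1) (cumul x p.1 p.2.+1).

Definition move_up x x' : R :=
  \sum_(p : 'I_(nloc S) * 'I_k)
    weight p.1 * Num.max 0 (cumul x' p.1 p.2.+1 - cumul x p.1 p.2.+1).

Let d0 : 0 < d. Proof. by rewrite invr_gt0 ltr0n. Qed.
Let d1 : d <= 1. Proof. by rewrite invf_le1 ?ltr0n// ler1n. Qed.
Let eta0 : 0 <= eta.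
Proof. by rewrite subr_ge0 ler_ln ?posrE ?addr_gt0// lerDr. Qed.

Lemma step_exists x (q : nat) (i0 : 'I_(nloc S)) (h : 'I_k.+1 -> R) :
  stochastic x -> (q <= k)%N -> (forall j, 0 <= h j) ->
  (forall j j' : 'I_k.+1, (j <= j')%N -> h j' <= h j) ->
  exists x', is_state q x' /\
    forall y, is_state q y -> integral_state y ->
      potential 1 y x' + eta * \sum_(j < k.+1) h j * x' i0 j
        <= potential 1 y x + eta * \sum_(j < k.+1) h j * y i0 j /\
      potential 2 y x' + move_up x x' / 3
        <= potential 2 y x + 2 * eta * \sum_(j < k.+1) h j * y i0 j.
Proof.
move=> sx qk h0 hmono.
pose lam j := h (inord j) - h (inord j.+1).
have lam0 j : (j < k)%N -> 0 <= lam j.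
  by move=> jk; rewrite subr_ge0 hmono// !inordK// ltnS ltnW.
have hE z : stochastic z ->
    \sum_(j < k.+1) h j * z i0 j =
    h (inord k) + \sum_(j < k) lam j * cumul z i0 j.+1.
  move=> sz; have := sum_cumul i0 (fun j => h (inord j)) sz.
  by under eq_bigr do rewrite inord_val.
pose L i j := ln (cumul x i j.+1 + d).
(* The cost increments may break monotonicity in the level. Regression restores it and keeps
   [m <= L], as [L] is a monotone majorant of [v]. *)
pose v j := L i0 j - eta * lam j / weight i0.
have w0 := @weight_gt0 R S.
have [m0 [m0mono m0L m0f _]] := isotonic_regression k v.
pose m (i : 'I_(nloc S)) j := if i == i0 then m0 j else L i j.
have Lmono i j j' : (j <= j' < k)%N -> L i j <= L i j'.
  move=> jj'; have c0 l : (l < k)%N -> 0 < cumul x i l.+1 + d.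
    move=> lk; rewrite ltr_wpDl//; have := @cumul01 _ _ _ x i l.+1 sx.
    by rewrite ltnS => /(_ (ltnW lk)) /andP[].
  rewrite ler_ln ?posrE ?c0 ?lerD2r; try lia.
  apply: cumul_mono => //; lia.
have mmono i j j' : (j <= j' < k)%N -> m i j <= m i j'.
  by rewrite /m; case: eqP => _ ?; [exact: m0mono|exact: Lmono].
have mL i j : (j < k)%N -> m i j <= L i j.
  rewrite /m; case: eqP => // -> jk; apply: m0L => // [? ?|l lk]; first exact: Lmono.
  by rewrite gerBl divr_ge0 ?mulr_ge0 ?lam0// ltW.
pose N : R := (nloc S * k)%:R - q%:R.
have FN : #|{: 'I_(nloc S) * 'I_k}|%:R = N + q%:R.
  by rewrite card_prod !card_ord subrK.
have [|A [A0 NZ tight]] := @exists_multiplier R ('I_(nloc S) * 'I_k)%type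
    (fun p => weight p.1) (fun p => m p.1 p.2) d N (fun p => w0 p.1).
  by rewrite FN lerDl.
pose Z (i : 'I_(nloc S)) j := clip01 (expR (m i j + A / weight i) - d).
have sx' : stochastic (of_levels k Z).
  apply: stochastic_of_levels => [i j|i j j' jj']; first by rewrite clip01_ge0 clip01_le1.
  by apply: le_clip01; rewrite lerB// ler_expR lerD// mmono.
have cE i (j : 'I_k) : cumul (of_levels k Z) i j.+1 = Z i j.
  by rewrite cumul_of_levels ?ltn_ord// ltnW.
exists (of_levels k Z); split.
  by apply/is_stateP => //; under eq_bigr do rewrite cE.
move=> y sqy iy; have sy := is_state_stochastic sqy.
have Ny := (is_stateP q sy).1 sqy.
have y01 (p : 'I_(nloc S) * 'I_k) :
    cumul y p.1 p.2.+1 = 0 \/ cumul y p.1 p.2.+1 = 1.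
  by apply: cumul_integral => //; rewrite ltnS ltnW.
have x01 (p : 'I_(nloc S) * 'I_k) : 0 <= cumul x p.1 p.2.+1 <= 1.
  by apply: cumul01 => //; rewrite ltnS ltnW.
have mL' (p : 'I_(nloc S) * 'I_k) : m p.1 p.2 <= ln (cumul x p.1 p.2.+1 + d).
  exact: mL.
(* The true lowering [L - m] may replace the intended one [L - v]. The regression is applied with
   [f] the map from log-level to final level, which involves the multiplier [A] chosen after [m]. *)
have hitE c : 0 <= c ->
    eta * \sum_(j < k) lam j * (Z i0 j - c * cumul y i0 j.+1) <=
    \sum_(p : 'I_(nloc S) * 'I_k) (Z p.1 p.2 - c * cumul y p.1 p.2.+1) *
      (weight p.1 * (L p.1 p.2 - m p.1 p.2)).
  move=> c0.
  rewrite -(pair_bigA _ (fun i (j : 'I_k) => (Z i j - c * cumul y i j.+1) *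
      (weight i * (L i j - m i j))))/=.
  rewrite [leRHS](bigD1 i0)//= [X in _ <= _ + X]big1 ?addr0 => [|i ii0]; last first.
    by apply: big1 => j _; rewrite /m (negbTE ii0) subrr !mulr0.
  have := m0f (fun t => clip01 (expR (t + A / weight i0) - d))
              (fun j => c * cumul y i0 j.+1).
  have -> : \sum_(l < k) (clip01 (expR (m0 l + A / weight i0) - d)
      - c * cumul y i0 l.+1) * (m0 l - v l) =
      \sum_(l < k) (Z i0 l - c * cumul y i0 l.+1) * (m i0 l - v l).
    by apply: eq_bigr => l _; rewrite /Z /m eqxx.
  move=> le0; have {}le0 : weight i0 * \sum_(l < k)
      (Z i0 l - c * cumul y i0 l.+1) * (m i0 l - v l) <= 0.
    rewrite pmulr_rle0//; apply: le0 => a b ab; apply: ler_wpM2l => //.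
    apply: cumul_mono => //; lia.
  rewrite -subr_ge0; rewrite -oppr_ge0 in le0; apply: le_trans le0 _.
  rewrite !mulr_sumr -sumrN -sumrB le_eqVlt; apply/orP; left; apply/eqP.
  apply: eq_bigr => j _; rewrite /v; field.
  by rewrite gt_eqF.
have w0' (p : 'I_(nloc S) * 'I_k) : 0 < weight p.1 by [].
have FNle : #|{: 'I_(nloc S) * 'I_k}|%:R <= N + q%:R by rewrite FN.
(* The shift [1/k] is chosen for this bound, given [q <= k]. *)
have dq : d * q%:R <= 1 by rewrite mulrC ler_pdivrMr ?ltr0n// mul1r ler_nat.
have p1 := pot1_pages_step (F := ('I_(nloc S) * 'I_k)%type) (d := d)
  (w := fun p => weight p.1) (old := fun p => cumul x p.1 p.2.+1)
  (m := fun p => m p.1 p.2)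
  d0 w0' A0 x01 y01 tight Ny.
have p2 := pot2_pages_step (F := ('I_(nloc S) * 'I_k)%type) (d := d)
  (w := fun p => weight p.1) (old := fun p => cumul x p.1 p.2.+1)
  (m := fun p => m p.1 p.2)
  d0 d1 w0' A0 x01 y01 mL' tight Ny FNle dq.
have potE c : potential c y (of_levels k Z) =
    \sum_(p : 'I_(nloc S) * 'I_k)
    weight p.1 * pot_term d c (cumul y p.1 p.2.+1) (Z p.1 p.2).
  by apply: eq_bigr => p _; rewrite cE.
have upE : move_up x (of_levels k Z) = \sum_(p : 'I_(nloc S) * 'I_k)
    weight p.1 * Num.max 0 (Z p.1 p.2 - cumul x p.1 p.2.+1).
  by apply: eq_bigr => p _; rewrite cE.
have e1 := hitE 1 ler01; have e2 := hitE 2 (ler0n _ _).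
have hZ : \sum_(j < k.+1) h j * of_levels k Z i0 j =
    h (inord k) + \sum_(j < k) lam j * Z i0 j.
  by rewrite hE//; congr (_ + _); apply: eq_bigr => j _; rewrite cE.
rewrite hZ !potE upE (hE y sy).
split.
  have eZ : \sum_(j < k) lam j * (Z i0 j - 1 * cumul y i0 j.+1) =
      \sum_(j < k) lam j * Z i0 j - \sum_(j < k) lam j * cumul y i0 j.+1.
    by rewrite -sumrB; apply: eq_bigr => j _; rewrite mul1r mulrBr.
  have eP : \sum_(p : 'I_(nloc S) * 'I_k) (Z p.1 p.2 - 1 * cumul y p.1 p.2.+1) *
      (weight p.1 * (L p.1 p.2 - m p.1 p.2)) =
      \sum_(p : 'I_(nloc S) * 'I_k) (Z p.1 p.2 - cumul y p.1 p.2.+1) *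
      (weight p.1 * (L p.1 p.2 - m p.1 p.2)).
    by apply: eq_bigr => p _; rewrite mul1r.
  rewrite eP eZ in e1; have := le_trans (lerD (lexx _) e1) p1.
  rewrite /potential; lra.
have {}p2 := le_trans (lerD (lexx _) e2) p2.
have eZ : \sum_(j < k) lam j * (Z i0 j - 2 * cumul y i0 j.+1) =
    \sum_(j < k) lam j * Z i0 j - 2 * \sum_(j < k) lam j * cumul y i0 j.+1.
  by rewrite mulr_sumr -sumrB; apply: eq_bigr => j _; ring.
rewrite eZ in p2.
have : 0 <= eta * \sum_(j < k) lam j * Z i0 j.
  by rewrite mulr_ge0// sumr_ge0// => j _; rewrite mulr_ge0 ?lam0// clip01_ge0.
have : 0 <= eta * h (inord k) by rewrite mulr_ge0.
move: p2; rewrite /potential; lra.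
Qed.

End Step.

(** * Amortized analysis *)

Definition serve_cost (R : realType) (S : star R) (k : nat) (r : request S k)
    (x : state S k) : R :=
  \sum_(j < k.+1) req_cost r j * x (req_loc r) j.

(** The inequalities hold for all integral [y] at once, so a step can be chosen without knowing the
    comparator. The guard sets aside [k = 0], where there are no levels and [k%:R^-1] is the default
    value 0. *)
Definition good_step (R : realType) (S : star R) (k : nat) (x : state S k)
    (r : request S k) (x' : state S k) : Prop :=
  is_state (req_quota r) x' /\
  ((0 < k)%N -> forall y, is_state (req_quota r) y -> integral_state y ->
    potential 1 y x' + ln (1 + k%:R) * serve_cost r x'
      <= potential 1 y x + ln (1 + k%:R) * serve_cost r y /\
    potential 2 y x' + move_up x x' / 3
      <= potential 2 y x + 2 * ln (1 + k%:R) * serve_cost r y).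

Lemma ln1Dn (R : realType) (k : nat) : (0 < k)%N ->
  ln (1 + k%:R) = ln (1 + k%:R^-1) - ln (k%:R^-1) :> R.
Proof.
move=> k0; have k0' : 0 < k%:R :> R by rewrite ltr0n.
rewrite -ln_div ?posrE ?addr_gt0 ?invr_gt0//; congr ln.
by rewrite invrK mulrDl mul1r mulVf ?gt_eqF// addrC.
Qed.

Lemma good_step_exists (R : realType) (S : star R) (k : nat) (x : state S k)
    (r : request S k) :
  stochastic x -> (req_quota r <= k)%N -> (forall j, 0 <= req_cost r j) ->
  (forall j j' : 'I_k.+1, (j <= j')%N -> req_cost r j' <= req_cost r j) ->
  exists x', good_step x r x'.
Proof.
move=> sx qk h0 hm; case: (posnP k) => k0.
  exists x; split; last by rewrite {1}k0.
  apply/is_stateP => //; apply: (@le_trans _ _ 0).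
    by rewrite (_ : (nloc S * k = 0)%N) ?sub0r ?oppr_le0// k0 muln0.
  apply: sumr_ge0 => p _; have := @cumul01 _ _ _ x p.1 p.2.+1 sx.
  by rewrite ltnS => /(_ (ltnW (ltn_ord _))) /andP[].
have [x' [sx' hx']] := step_exists k0 (req_loc r) sx qk h0 hm.
by exists x'; split=> // _ y sy iy; rewrite !ln1Dn//; exact: hx'.
Qed.

(** Choice among good steps, depending only on the current state and request, hence online; [x] is
    the default when there is none. *)
Definition prox_step (R : realType) (S : star R) (k : nat) (x : state S k)
  (r : request S k) : state S k := xget x (good_step x r).

Definition prox_algorithm (R : realType) : online_algorithm R :=
  fun S k x _ rs => foldl (@prox_step R S k) x rs.

Section Run.
Variables (R : realType) (S : star R) (k : nat) (I : instance S k).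
Hypothesis vI : valid_instance I.
Local Notation x := (run (@prox_algorithm R) I).
Local Notation req t := (Request (kappa I t) (loc I t) (hcost I t)).

Lemma run_prox_state t : is_state (kappa I t) (x t) /\
  good_step (x t) (req t.+1) (x t.+1).
Proof.
have [kq hI sI iI] := vI.
have xE s : x s = foldl (@prox_step R S k) (start I) (history I s) by case: s.
have xS s : x s.+1 = prox_step (x s) (req s.+1).
  rewrite !xE /history -[s.+1]addn1 iotaD map_cat foldl_cat/= add1n addn1//.
have good s : is_state (kappa I s) (x s) -> good_step (x s) (req s.+1) (x s.+1).
  move=> ss; rewrite xS; apply: xgetPex; apply: good_step_exists.
  - exact: is_state_stochastic ss.
  - exact: kq.
  - exact: (hI s.+1 isT).1.
  - exact: (hI s.+1 isT).2.
have st : is_state (kappa I t) (x t) by elim: t => // t /good[].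
by split => //; exact: good.
Qed.

Lemma potential_id (c : R) (y : state S k) : potential c y y = 0.
Proof. by apply: big1 => p _; rewrite pot_term_id mulr0. Qed.

Lemma moveE (y y' : state S k) : move y y' =
  \sum_(p : 'I_(nloc S) * 'I_k)
    weight p.1 * `|cumul y' p.1 p.2.+1 - cumul y p.1 p.2.+1|.
Proof.
rewrite -(pair_bigA _ (fun i (j : 'I_k) =>
  weight i * `|cumul y' i j.+1 - cumul y i j.+1|))/=.
by apply: eq_bigr => i _; rewrite big_add1 big_mkord mulr_sumr.
Qed.

Definition level (y : state S k) : R :=
  \sum_(p : 'I_(nloc S) * 'I_k) weight p.1 * cumul y p.1 p.2.+1.

Let w0 (i : 'I_(nloc S)) : 0 <= weight i. Proof. exact: ltW (weight_gt0 i). Qed.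

(** From [|a| = 2 * max(0, a) - a]; along a run the level differences telescope. *)
Lemma move_level (y y' : state S k) :
  move y y' = 2 * move_up y y' + level y - level y'.
Proof.
rewrite moveE /move_up /level mulr_sumr -big_split -sumrB/=.
apply: eq_bigr => p _; case: leP => h.
  by rewrite ger0_norm//; ring.
by rewrite ltr0_norm//; ring.
Qed.

Lemma level_move (y y' : state S k) : level y - level y' <= move y y'.
Proof.
rewrite moveE /level -sumrB; apply: ler_sum => p _.
by rewrite -mulrBr ler_wpM2l// -[leRHS]normrN opprB ler_norm.
Qed.

Lemma hit_recr T (y : nat -> state S k) : hit I T.+1 y =
  hit I T y + \sum_(j < k.+1) hcost I T.+1 j * y T.+1 (loc I T.+1) j.
Proof. by rewrite /hit big_nat_recr. Qed.

Lemma mov_recr T (y : nat -> state S k) :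
  mov T.+1 y = mov T y + move (y T) (y T.+1).
Proof. by rewrite /mov big_nat_recr. Qed.

Lemma mov_ge0 T (y : nat -> state S k) : 0 <= mov T y.
Proof.
apply: sumr_ge0 => t _; rewrite moveE; apply: sumr_ge0 => p _.
by rewrite mulr_ge0.
Qed.

Lemma hit_ge0 T (y : nat -> state S k) : solution I T y -> 0 <= hit I T y.
Proof.
move=> [_ sy]; rewrite /hit big_nat_cond; apply: sumr_ge0 => t.
rewrite andbT ltnS => tT; apply: sumr_ge0 => j _.
have [_ hI _ _] := vI; have [y0 _ _] := sy t tT.
by apply: mulr_ge0 => //; apply: (hI t _).1; case/andP: tT.
Qed.

(** * Comparison with one integral solution *)

Section Compare.
Variables (T : nat) (y : nat -> state S k).
Hypotheses (sy : solution I T y) (iy : forall t, (t <= T)%N -> integral_state (y t)).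

Let sty t : (t <= T)%N -> is_state (kappa I t) (y t).
Proof.
case: sy => y0 ys; case: t => [_|t tT]; last exact: ys.
by rewrite y0; case: vI.
Qed.

Lemma hit_k0 : k = 0%N -> hit I T x = hit I T y.
Proof.
move=> k0; rewrite /hit !big_nat; apply: eq_bigr => t; rewrite ltnS => /andP[_ tT].
apply: eq_bigr => j _; congr (_ * _).
have one (z : state S k) : stochastic z -> z (loc I t) j = 1.
  move=> [_ /(_ (loc I t))]; rewrite (bigD1 j)//= big1 ?addr0// => l.
  by case: (l) (j) => [a aP] [b bP]; rewrite -val_eqE/=; lia.
rewrite !one//; apply: is_state_stochastic; first exact: sty.
exact: (run_prox_state t).1.
Qed.

Hypothesis k0 : (0 < k)%N.
Local Notation eta := (ln (1 + k%:R) : R).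

Let d0 : 0 < k%:R^-1 :> R. Proof. by rewrite invr_gt0 ltr0n. Qed.
Let d1 : k%:R^-1 <= 1 :> R. Proof. by rewrite invf_le1 ?ltr0n// ler1n. Qed.

Let y01 t (p : 'I_(nloc S) * 'I_k) : (t <= T)%N ->
  cumul (y t) p.1 p.2.+1 = 0 \/ cumul (y t) p.1 p.2.+1 = 1.
Proof.
move=> tT; apply: cumul_integral; [exact: is_state_stochastic (sty tT)|exact: iy|].
by rewrite ltnS ltnW.
Qed.

Let x01 t (p : 'I_(nloc S) * 'I_k) : 0 <= cumul (x t) p.1 p.2.+1 <= 1.
Proof.
apply: cumul01; first exact: is_state_stochastic (run_prox_state t).1.
by rewrite ltnS ltnW.
Qed.

Lemma potential_move (c : R) t : 1 <= c -> (t < T)%N ->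
  potential c (y t.+1) (x t) <=
  potential c (y t) (x t) + c * eta * move (y t) (y t.+1).
Proof.
move=> c1 tT; rewrite moveE mulr_sumr -big_split/=; apply: ler_sum => p _.
rewrite [X in _ + X]mulrCA -mulrDr ler_wpM2l// ln1Dn//.
by apply: pot_term_lipschitz => //; apply: y01 => //; exact: ltnW.
Qed.

(** Amortization from potential 0 at the common start: at each time the comparator moves first, at
    Lipschitz cost, and then the algorithm steps. *)
Lemma hit_potential t : (t <= T)%N ->
  potential 1 (y t) (x t) + eta * hit I t x <= eta * (hit I t y + mov t y).
Proof.
elim: t => [_|t IHt tT].
  by rewrite /hit /mov !big_geq// addr0 mulr0 addr0 sy.1 potential_id.
have := IHt (ltnW tT); have := potential_move (lexx 1) tT.
have := ((run_prox_state t).2.2 k0 _ (sty tT) (iy tT)).1.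
rewrite !hit_recr mov_recr /serve_cost /=; lra.
Qed.

Lemma up_potential t : (t <= T)%N ->
  potential 2 (y t) (x t) + (\sum_(s < t) move_up (x s) (x s.+1)) / 3 <=
  2 * eta * (hit I t y + mov t y).
Proof.
elim: t => [_|t IHt tT].
  by rewrite /hit /mov !big_geq// big_ord0 addr0 mulr0 mul0r addr0 sy.1 potential_id.
rewrite big_ord_recr hit_recr mov_recr.
have := IHt (ltnW tT); have := potential_move (ler1n R 2) tT.
have := ((run_prox_state t).2.2 k0 _ (sty tT) (iy tT)).2.
rewrite /serve_cost /=; lra.
Qed.

Lemma mov_up t : mov t x =
  2 * (\sum_(s < t) move_up (x s) (x s.+1)) + level (start I) - level (x t).
Proof.
elim: t => [|t IHt]; first by rewrite /mov big_geq// big_ord0 mulr0 add0r subrr.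
rewrite mov_recr IHt big_ord_recr move_level /=; lra.
Qed.

Lemma level_mov t : level (y 0%N) - level (y t) <= mov t y.
Proof.
elim: t => [|t IHt]; first by rewrite /mov big_geq// subrr.
rewrite mov_recr; have := level_move (y t) (y t.+1); lra.
Qed.

Lemma level_potential (b c : R) t : 0 <= b -> 1 + 2 * b <= c -> (t <= T)%N ->
  b * (level (y t) - level (x t)) <= potential c (y t) (x t).
Proof.
move=> b0 bc tT; rewrite /level -sumrB mulr_sumr; apply: ler_sum => p _.
rewrite -mulrBr mulrCA ler_wpM2l//.
by apply: pot_term_ge => //; exact: y01.
Qed.

Lemma eta_ge_half : 1 / 2 <= eta.
Proof. by rewrite ln1Dn//; exact: ln_gap_ge_half. Qed.

Lemma hit_le_cost : hit I T x <= hit I T y + mov T y.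
Proof.
have e0 : 0 < eta by have := eta_ge_half; lra.
rewrite -(ler_pM2l e0); have := hit_potential (leqnn T).
have : 0 * (level (y T) - level (x T)) <= potential 1 (y T) (x T).
  by apply: level_potential => //; lra.
lra.
Qed.

Lemma mov_le_cost : mov T x <= 18 * eta * (hit I T y + mov T y).
Proof.
have := up_potential (leqnn T).
have : 1 / 2 * (level (y T) - level (x T)) <= potential 2 (y T) (x T).
  by apply: level_potential => //; lra.
have : 0 * (level (y T) - level (x T)) <= potential 2 (y T) (x T).
  by apply: level_potential => //; lra.
(* With [K] the cost of [y], twice the upward movement is at most [12 * eta * K], the final excess
   of [y] over [x] at most [4 * eta * K], and [mov T y <= K <= 2 * eta * K]: in total 18. *)
rewrite mov_up; have := level_mov T; have := hit_ge0 sy.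
have c0 : 0 <= hit I T y + mov T y by rewrite addr_ge0 ?hit_ge0// mov_ge0.
have : 0 <= \sum_(s < T) move_up (x s) (x s.+1).
  apply: sumr_ge0 => s _; apply: sumr_ge0 => p _.
  by rewrite mulr_ge0// le_max lexx.
have := ler_wpM2r c0 eta_ge_half; rewrite sy.1; lra.
Qed.

End Compare.

Lemma integral_solution_exists T : exists y : nat -> state S k,
  solution I T y /\ forall t, (t <= T)%N -> integral_state (y t).
Proof.
have [_ _ sI iI] := vI.
(* No server anywhere: feasible under every quota, so the set of costs behind [opt] is nonempty. *)
pose e : state S k := of_levels k (fun _ _ => 1).
have se : stochastic e by apply: stochastic_of_levels => //= *; rewrite ler01 lexx.
exists (fun t => if t is 0 then start I else e); split.
  split => // -[|t]// _; apply/is_stateP => //.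
  rewrite (eq_bigr (fun=> 1)) => [|p _]; last by rewrite cumul_of_levels ?ltn_ord// ltnW.
  by rewrite sumr_const card_prod !card_ord gerBl.
case=> // t _ i j; rewrite mxE; case: j => [[|j] /= jk].
  by right; rewrite subr0; case: ifP.
by left; rewrite !if_same subrr.
Qed.

Lemma le_opt T (a : R) :
  (forall y, solution I T y -> (forall t, (t <= T)%N -> integral_state (y t)) ->
    a <= hit I T y + mov T y) -> a <= opt I T.
Proof.
move=> ha; apply: lb_le_inf => [|_ [y [sy iy ->]]]; last exact: ha.
by have [y [sy iy]] := integral_solution_exists T; exists (hit I T y + mov T y), y.
Qed.

Lemma hit_le_opt T : hit I T x <= opt I T.
Proof.
apply: le_opt => y sy iy; case: (posnP k) => k0; last exact: hit_le_cost.
by rewrite (hit_k0 sy)// lerDl mov_ge0.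
Qed.

Lemma mov_le_opt T : mov T x <= 18 * ln (1 + k%:R) * opt I T.
Proof.
case: (posnP k) => k0.
  rewrite (_ : ln (1 + k%:R) = 0) ?mulr0 ?mul0r; last by rewrite k0 addr0 ln1.
  rewrite /mov big1// => t _; rewrite moveE.
  by apply: big1 => -[i [j jk]] _; exfalso; move: jk; rewrite k0.
have e0 : 0 < 18 * ln (1 + k%:R) :> R.
  by have := eta_ge_half k0; lra.
rewrite -ler_pdivrMl//; apply: le_opt => y sy iy.
by rewrite ler_pdivrMl//; exact: mov_le_cost.
Qed.

Lemma opt_ge0 T : 0 <= opt I T.
Proof. by apply: le_opt => y sy _; rewrite addr_ge0 ?hit_ge0// mov_ge0. Qed.

End Run.

Theorem theorem3p6 (R : realType) :
  exists c : R, forall eps : R, 0 < eps <= 1 ->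
  exists (A : online_algorithm R)
         (C : forall (S : star R) (k : nat), state S k -> state S k -> R),
    (forall (S : star R) (k : nat) (x : state S k), C S k x x = 0) /\
    forall (S : star R) (k : nat) (I : instance S k), valid_instance I ->
    forall T : nat,
      [/\ solution I T (run A I),
          hit I T (run A I) <=
            (1 + eps) * (opt I T + wmax S * quota_var I T)
            + C S k (start I) (run A I T) &
          mov T (run A I) <=
            c * ln (1 + k%:R / eps) * (opt I T + wmax S * quota_var I T)].
Proof.
(* The same algorithm is taken for every [eps], with zero additive term; the bounds against [opt]
   are then relaxed to the stated ones. *)
exists 18 => eps /andP[e0 e1]; exists (@prox_algorithm R), (fun _ _ _ _ => 0); split=> //.
move=> S k I vI T.
have g0 : 0 <= wmax S * quota_var I T.
  apply: mulr_ge0; last by apply: sumr_ge0.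
  by rewrite /wmax; apply: (big_ind (fun r : R => 0 <= r)) => // [a b a0 b0|i _];
     rewrite ?le_max ?a0// ltW// weight_gt0.
have o0 := opt_ge0 vI T.
have o1 : opt I T <= opt I T + wmax S * quota_var I T by rewrite lerDl.
split.
- by split => // t _; exact: (run_prox_state vI t).1.
- rewrite addr0; apply: le_trans (hit_le_opt vI T) _; apply: (le_trans o1).
  by rewrite ler_peMl ?addr_ge0// lerDl ltW.
(* Since [eps <= 1], the factor [ln (1 + k)] is at most [ln (1 + k / eps)]. *)
- have ke : k%:R <= k%:R / eps by rewrite ler_peMr// invf_ge1.
  apply: le_trans (mov_le_opt vI T) _; apply: ler_pM => //.
    by rewrite mulr_ge0// ln_ge0// lerDl.
  have k0 : 0 <= k%:R :> R by [].
  rewrite ler_pM2l// ler_ln ?posrE ?lerD2l// ltr_pwDl//.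
  exact: le_trans ke.
Qed.
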